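(* Let $M$ be a countable transitive model of $\mathsf{ZF}^-$ and let $\mathbb{P}$ be a partial order that is definable over $M$. If $\mathbb{P}$ satisfies the definability lemma for either the formula ''$v_0\in v_1$'' or the formula ''$v_0=v_1$'' over $M$, then $\mathbb{P}$ satisfies the forcing theorem for all $\mathcal{L}_\in$-formulae over $M$.
   Context: We work in a model $\mathsf{V}$ of $\mathsf{ZFC}$. $\mathsf{ZF}^-$ denotes the axioms of $\mathsf{ZF}$ without the power set axiom and with Collection instead of Replacement. $\mathcal{L}_\in$ is the first-order language of set theory. ''Definable over $M$'' means first-order definable over $\langle M,\in\rangle$, parameters from $M$ being allowed; a partial order $\mathbb{P}$ is definable over $M$ if both its domain (a subset of $M$) and its relation $\leq_{\mathbb{P}}$ are definable over $M$. A filter $G$ on $\mathbb{P}$ is $\mathbb{P}$-generic over $M$ if it meets every dense subset of $\mathbb{P}$ that is definable over $M$. A $\mathbb{P}$-name is a set all of whose elements are of the form $\langle\tau,p\rangle$ with $\tau$ a $\mathbb{P}$-name and $p\in\mathbb{P}$; $M^{\mathbb{P}}$ is the collection of all $\mathbb{P}$-names in $M$. For a $\mathbb{P}$-generic filter $G$ let $\sigma^G=\{\tau^G\mid \exists p\in G\ \langle\tau,p\rangle\in\sigma\}$ and $M[G]=\{\sigma^G\mid\sigma\in M^{\mathbb{P}}\}$. For an $\mathcal{L}_\in$-formula $\varphi(v_0,\ldots,v_{n-1})$, $p\in\mathbb{P}$ and $\sigma_0,\ldots,\sigma_{n-1}\in M^{\mathbb{P}}$, write $p\Vdash^M_{\mathbb{P}}\varphi(\sigma_0,\ldots,\sigma_{n-1})$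 if $\varphi(\sigma_0^G,\ldots,\sigma_{n-1}^G)$ holds in $M[G]$ whenever $G$ is $\mathbb{P}$-generic over $M$ with $p\in G$. $\mathbb{P}$ satisfies the definability lemma for $\varphi$ over $M$ if the set $\{\langle p,\sigma_0,\ldots,\sigma_{n-1}\rangle\in\mathbb{P}\times M^{\mathbb{P}}\times\cdots\times M^{\mathbb{P}}\mid p\Vdash^M_{\mathbb{P}}\varphi(\sigma_0,\ldots,\sigma_{n-1})\}$ is definable over $M$. $\mathbb{P}$ satisfies the truth lemma for $\varphi$ over $M$ if for all $\sigma_0,\ldots,\sigma_{n-1}\in M^{\mathbb{P}}$ and every $\mathbb{P}$-generic filter $G$ over $M$ such that $\varphi(\sigma_0^G,\ldots,\sigma_{n-1}^G)$ holds in $M[G]$, there is $p\in G$ with $p\Vdash^M_{\mathbb{P}}\varphi(\sigma_0,\ldots,\sigma_{n-1})$. $\mathbb{P}$ satisfies the forcing theorem for $\varphi$ over $M$ if it satisfies both the definability lemma and the truth lemma for $\varphi$ over $M$. *)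

(* Defs.v *)
From Stdlib Require Import Wellfounded.
From HB Require Import structures.
From mathcomp Require Import all_boot.
From mathcomp Require Import boolp classical_sets functions cardinality.

Set Implicit Arguments.
Unset Strict Implicit.
Unset Printing Implicit Defensive.

Local Open Scope classical_set_scope.

(** * The universe of sets

   [V] is Aczel's type of well-founded trees modulo bisimilarity.  Bisimilarity
   classes are taken as elements, so that equality of sets is Leibniz equality.
   The lemmas [V_extensionality], [V_foundation], [V_pairing], [V_union],
   [V_powerset], [V_infinity], [V_separation], [V_replacement] and [V_choice]
   show that [V] is a model of ZFC, with separation and replacement for all
   predicates on [V].  A subclass of [V] included in a set is itself a set, so
   that subsets of a set are represented as subclasses. *)

Inductive tree : Type := Node (A : Type) (f : A -> tree).

Fixpoint bisim (s t : tree) {struct s} : Prop :=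
  match s, t with
  | Node A f, Node B g =>
      (forall a, exists b, bisim (f a) (g b)) /\
      (forall b, exists a, bisim (f a) (g b))
  end.

Lemma bisim_refl t : bisim t t.
Proof. by elim: t => A f IH /=; split=> a; exists a. Qed.

Lemma bisim_sym s t : bisim s t -> bisim t s.
Proof.
elim: s t => A f IH [B g] /= [fg gf]; split.
- by move=> b; have [a /IH] := gf b; exists a.
- by move=> a; have [b /IH] := fg a; exists b.
Qed.

Lemma bisim_trans s t u : bisim s t -> bisim t u -> bisim s u.
Proof.
elim: s t u => A f IH [B g] [C h] /= [fg gf] [gh hg]; split.
- by move=> a; have [b fgb] := fg a; have [c ghc] := gh b; exists c; apply: IH ghc.
- by move=> c; have [b ghc] := hg c; have [a fga] := gf b; exists a; apply: IH ghc.
Qed.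

Definition V : Type := {C : tree -> Prop | exists t, C = bisim t}.

HB.instance Definition _ := gen_eqMixin V.
HB.instance Definition _ := gen_choiceMixin V.

Definition set_of_tree (t : tree) : V :=
  exist _ (bisim t) (ex_intro _ t (erefl (bisim t))).

Lemma set_of_treeP s t : set_of_tree s = set_of_tree t <-> bisim s t.
Proof.
split=> [[] e|st]; first by rewrite e; apply: bisim_refl.
apply: eq_exist; apply/funext => u; apply/propext; split.
- exact: bisim_trans (bisim_sym st).
- exact: bisim_trans st.
Qed.

Lemma set_of_tree_surj x : exists t, x = set_of_tree t.
Proof. by case: x => C [t Ct]; exists t; apply: eq_exist. Qed.

Definition elem (x y : V) : Prop :=
  exists (A : Type) (f : A -> tree) (a : A),
    y = set_of_tree (Node f) /\ x = set_of_tree (f a).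

Notation "x ∈ y" := (elem x y) (at level 70).

Definition tree_of (x : V) : tree := projT1 (cid (set_of_tree_surj x)).

Lemma tree_ofK x : set_of_tree (tree_of x) = x.
Proof. by rewrite /tree_of; case: cid. Qed.

(** The set [{f a | a : A}]. *)
Definition vfamily (A : Type) (f : A -> V) : V :=
  set_of_tree (Node (fun a => tree_of (f a))).

Lemma in_set_of_tree x A (f : A -> tree) :
  x ∈ set_of_tree (Node f) <-> exists a, x = set_of_tree (f a).
Proof.
split=> [[B [g [b [/set_of_treeP /= [_ gf] ->]]]]|[a ->]].
- by have [a /set_of_treeP] := gf b; exists a.
- by exists A, f, a.
Qed.

Lemma in_vfamily x A (f : A -> V) : x ∈ vfamily f <-> exists a, x = f a.
Proof.
by rewrite in_set_of_tree; split=> -[a]; exists a; rewrite ?tree_ofK // -[f a]tree_ofK.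
Qed.

Definition small (C : set V) : Prop := exists x, forall y, y ∈ x <-> C y.

(** The set with the same elements as [C], meaningful when [C] is small. *)
Definition setof (C : set V) : V :=
  xget (vfamily (of_void V)) [set x | forall y, y ∈ x <-> C y].

Lemma in_setof C : small C -> forall y, y ∈ setof C <-> C y.
Proof. exact: (@xgetPex V _ [set x | forall y, y ∈ x <-> C y]). Qed.

Lemma small_range (A : Type) (f : A -> V) (C : set V) :
  (forall y, C y -> exists a, y = f a) -> small C.
Proof.
move=> Cf; exists (vfamily (fun a : {a | C (f a)} => f (proj1_sig a))) => y.
rewrite in_vfamily; split=> [[[a Ca] ->] //|Cy].
by have [a ya] := Cf y Cy; rewrite ya in Cy *; exists (exist _ a Cy).
Qed.

Lemma V_vfamily x : exists (A : Type) (f : A -> V), x = vfamily f.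
Proof.
have [[A f] ->] := set_of_tree_surj x; exists A, (fun a => set_of_tree (f a)).
by apply/set_of_treeP; split=> a; exists a; apply/set_of_treeP; rewrite tree_ofK.
Qed.

Lemma countable_small (C : set V) : countable C -> small C.
Proof.
move=> /pfcard_geP [->|[g]].
  by exists (vfamily (of_void V)) => y; rewrite in_vfamily; split=> [[[]]|[]].
apply: (@small_range nat (fun n => g n)) => y Cy.
by have [n _ <-] := @surj _ _ _ _ g y Cy; exists n.
Qed.

Lemma V_extensionality x y : (forall z, z ∈ x <-> z ∈ y) -> x = y.
Proof.
have [A [f ->]] := V_vfamily x; have [B [g ->]] := V_vfamily y => fg.
apply/set_of_treeP; split=> [a|b].
- have /fg/in_vfamily[b fb] : f a ∈ vfamily f by apply/in_vfamily; exists a.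
  by exists b; apply/set_of_treeP; rewrite !tree_ofK.
- have /fg/in_vfamily[a ga] : g b ∈ vfamily g by apply/in_vfamily; exists b.
  by exists a; apply/set_of_treeP; rewrite !tree_ofK.
Qed.

Lemma V_foundation : well_founded elem.
Proof.
move=> x; have [t ->] := set_of_tree_surj x.
elim: t => A f IH; constructor=> y /in_set_of_tree[a ->]; exact: IH.
Qed.

Lemma V_pairing x y : small [set z | z = x \/ z = y].
Proof.
by apply: (@small_range bool (fun b => if b then x else y)) => z [] ->;
  [exists true|exists false].
Qed.

Lemma V_separation x (C : set V) : small [set z | z ∈ x /\ C z].
Proof.
have [A [f ->]] := V_vfamily x.
by apply: (@small_range A f) => y [/in_vfamily].
Qed.

Lemma V_replacement x (R : V -> V -> Prop) :
  (forall u v w, u ∈ x -> R u v -> R u w -> v = w) ->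
  small [set v | exists2 u, u ∈ x & R u v].
Proof.
have [A [f ->]] := V_vfamily x => Rfun.
apply: (@small_range A (fun a => xget (f a) [set v | R (f a) v])) => v.
move=> [_ /in_vfamily[a ->] Rav]; exists a.
apply: (Rfun (f a)) => //; first by apply/in_vfamily; exists a.
by apply: (@xgetPex V _ [set v | R (f a) v]); exists v.
Qed.

Lemma V_union x : small [set z | exists2 y, y ∈ x & z ∈ y].
Proof.
have [A [f ->]] := V_vfamily x.
pose X a := cid (V_vfamily (f a)); pose B a := projT1 (X a).
pose g a : B a -> V := projT1 (cid (projT2 (X a))).
have fg a : f a = vfamily (g a) := projT2 (cid (projT2 (X a))).
apply: (@small_range {a : A & B a} (fun u => g _ (projT2 u))) => z [y].
by move=> /in_vfamily[a ->]; rewrite fg => /in_vfamily[b ->]; exists (existT _ a b).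
Qed.

Lemma V_powerset x : small [set y | forall z, z ∈ y -> z ∈ x].
Proof.
have [A [f ->]] := V_vfamily x.
apply: (@small_range (A -> Prop)
  (fun Q => vfamily (fun a : {a | Q a} => f (proj1_sig a)))) => y yf.
exists (fun a => f a ∈ y); apply: V_extensionality => z; rewrite in_vfamily.
split=> [zy|[[a ay] -> //]].
by have /in_vfamily[a za] := yf z zy; rewrite za in zy *; exists (exist _ a zy).
Qed.

Lemma V_infinity : exists x,
  (exists2 e, e ∈ x & forall z, ~ z ∈ e) /\
  (forall y, y ∈ x -> exists2 s, s ∈ x & forall z, z ∈ s <-> z ∈ y \/ z = y).
Proof.
have succ_small y : small [set z | z ∈ y \/ z = y].
  have [A [f ->]] := V_vfamily y.
  apply: (@small_range (option A) (oapp f (vfamily f))) => z [/in_vfamily[a ->]|->].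
  - by exists (Some a).
  - by exists None.
pose succ y := setof [set z | z ∈ y \/ z = y].
pose num := fix num n := if n is m.+1 then succ (num m) else vfamily (of_void V).
exists (vfamily num); split.
- exists (num 0); first by apply/in_vfamily; exists 0.
  by move=> z /in_vfamily[[]].
- move=> y /in_vfamily[n ->]; exists (num n.+1).
    by apply/in_vfamily; exists n.+1.
  exact: in_setof (succ_small _).
Qed.

Lemma V_choice x :
  (forall y, y ∈ x -> exists z, z ∈ y) ->
  (forall y y' z, y ∈ x -> y' ∈ x -> z ∈ y -> z ∈ y' -> y = y') ->
  exists c, forall y, y ∈ x -> exists! z, z ∈ y /\ z ∈ c.
Proof.
move=> x_n0 x_disj; pose h y := xget y [set z | z ∈ y].
have hP y : y ∈ x -> h y ∈ y by move=> /x_n0; apply: (@xgetPex V _ [set z | z ∈ y]).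
have c_small : small [set z | exists2 y, y ∈ x & z = h y].
  by apply: V_replacement => u v w _ -> ->.
exists (setof [set z | exists2 y, y ∈ x & z = h y]) => y yx; exists (h y).
split=> [|z [zy]]; first by rewrite in_setof //; split; [exact: hP|exists y].
rewrite in_setof // => -[y' y'x zE]; rewrite zE in zy *.
by congr h; apply: (x_disj _ _ _ yx y'x zy); apply: hP.
Qed.

Definition upair (x y : V) : V := setof [set z | z = x \/ z = y].

Definition opair (x y : V) : V := upair (upair x x) (upair x y).

Notation "⟨ x , y ⟩" := (opair x y) (at level 0, x, y at level 99).

Lemma in_upair x y z : z ∈ upair x y <-> z = x \/ z = y.
Proof. exact: in_setof (V_pairing x y) z. Qed.

Lemma opair_inj x y x' y' : ⟨x, y⟩ = ⟨x', y'⟩ -> x = x' /\ y = y'.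
Proof.
have upairI a b c : upair a b = upair a c -> b = c.
  move=> e; have /in_upair[ba|//] : b ∈ upair a c by rewrite -e in_upair; right.
  by have /in_upair[->|->] : c ∈ upair a b by rewrite e in_upair; right.
have upair1 a b c : upair a a = upair b c -> a = b.
  by move=> e; have /in_upair[] : b ∈ upair a a by rewrite e in_upair; left.
move=> e; have xx' : x = x'.
  have /in_upair[/upair1 //|/upair1 //] : upair x x ∈ ⟨x', y'⟩.
  by rewrite -e in_upair; left.
by rewrite -xx' in e *; split=> //; apply: upairI (upairI _ _ _ e).
Qed.

(** * First-order formulas of set theory

   [formula n] is the type of formulas with free variables among
   [v_0, ..., v_(n-1)]; variables are de Bruijn indices, so that [FAll f] binds
   the variable [v_0] of [f]. *)

Inductive formula : nat -> Type :=
| FMem n of 'I_n & 'I_n : formula n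
| FEq n of 'I_n & 'I_n : formula n
| FNeg n of formula n : formula n
| FAnd n of formula n & formula n : formula n
| FAll n of formula n.+1 : formula n.

(** Satisfaction in the structure [(A, ∈)]. *)
Fixpoint sat (A : set V) n (f : formula n) : n.-tuple V -> Prop :=
  match f in formula n return n.-tuple V -> Prop with
  | FMem _ i j => fun e => tnth e i ∈ tnth e j
  | FEq _ i j => fun e => tnth e i = tnth e j
  | FNeg _ g => fun e => ~ sat A g e
  | FAnd _ g h => fun e => sat A g e /\ sat A h e
  | FAll _ g => fun e => forall x, A x -> sat A g [tuple of x :: e]
  end.

Definition tuple_in (A : set V) n (e : n.-tuple V) : Prop :=
  forall i, A (tnth e i).

(** First-order definability over [(A, ∈)], with parameters [a] from [A]. *)
Definition definable (A : set V) n (R : set (n.-tuple V)) : Prop :=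
  exists k (f : formula (n + k)) (a : k.-tuple V), tuple_in A a /\
    forall e, R e <-> tuple_in A e /\ sat A f [tuple of e ++ a].

Definition definable1 (A : set V) (C : set V) : Prop :=
  definable A [set e : 1.-tuple V | C (tnth e ord0)].

Definition definable2 (A : set V) (R : V -> V -> Prop) : Prop :=
  definable A [set e : 2.-tuple V | R (tnth e ord0) (tnth e ord_max)].

Definition transitive_class (A : set V) : Prop :=
  forall x y, A x -> y ∈ x -> A y.

(** * ZF without power set, with Collection instead of Replacement *)

Definition sat_extensionality (A : set V) : Prop :=
  forall x y, A x -> A y ->
    (forall z, A z -> (z ∈ x <-> z ∈ y)) -> x = y.

Definition sat_foundation (A : set V) : Prop :=
  forall x, A x -> (exists2 y, A y & y ∈ x) ->
    exists2 y, A y & y ∈ x /\ ~ (exists2 z, A z & z ∈ x /\ z ∈ y).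

Definition sat_pairing (A : set V) : Prop :=
  forall x y, A x -> A y ->
    exists2 u, A u & forall z, A z -> (z ∈ u <-> z = x \/ z = y).

Definition sat_union (A : set V) : Prop :=
  forall x, A x ->
    exists2 u, A u & forall z, A z ->
      (z ∈ u <-> exists2 y, A y & y ∈ x /\ z ∈ y).

Definition sat_infinity (A : set V) : Prop :=
  exists2 w, A w &
    (exists2 e, A e & e ∈ w /\ forall z, A z -> ~ z ∈ e) /\
    (forall x, A x -> x ∈ w ->
      exists2 s, A s & s ∈ w /\ forall z, A z -> (z ∈ s <-> z ∈ x \/ z = x)).

Definition sat_separation (A : set V) : Prop :=
  forall n (f : formula n.+1) (a : n.-tuple V), tuple_in A a ->
    forall x, A x ->
      exists2 y, A y & forall z, A z ->
        (z ∈ y <-> z ∈ x /\ sat A f [tuple of z :: a]).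

Definition sat_collection (A : set V) : Prop :=
  forall n (f : formula n.+2) (a : n.-tuple V), tuple_in A a ->
    forall x, A x ->
      (forall u, A u -> u ∈ x ->
        exists2 v, A v & sat A f [tuple of u :: v :: a]) ->
      exists2 y, A y & forall u, A u -> u ∈ x ->
        exists2 v, A v & v ∈ y /\ sat A f [tuple of u :: v :: a].

Record models_ZFminus (A : set V) : Prop := {
  ZFm_extensionality : sat_extensionality A;
  ZFm_foundation : sat_foundation A;
  ZFm_pairing : sat_pairing A;
  ZFm_union : sat_union A;
  ZFm_infinity : sat_infinity A;
  ZFm_separation : sat_separation A;
  ZFm_collection : sat_collection A
}.

(** A countable subclass of [V] is a set, by [countable_small]. *)
Record ctm_ZFminus (M : set V) : Prop := {
  ctm_countable : countable M;
  ctm_transitive : transitive_class M;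
  ctm_models : models_ZFminus M
}.

(** * Partial orders and generic filters *)

Record partial_order : Type := PartialOrder {
  po_dom : set V;
  po_le : V -> V -> Prop;
  po_le_dom : forall p q, po_le p q -> po_dom p /\ po_dom q;
  po_le_refl : forall p, po_dom p -> po_le p p;
  po_le_anti : forall p q, po_le p q -> po_le q p -> p = q;
  po_le_trans : forall p q r, po_le p q -> po_le q r -> po_le p r
}.

Definition definable_order (M : set V) (P : partial_order) : Prop :=
  definable1 M (po_dom P) /\ definable2 M (po_le P).

Definition dense (P : partial_order) (D : set V) : Prop :=
  D `<=` po_dom P /\ forall p, po_dom P p -> exists2 q, D q & po_le P q p.

Record filter_on (P : partial_order) (G : set V) : Prop := {
  filter_sub : G `<=` po_dom P;
  filter_nonempty : G !=set0;
  filter_up : forall p q, G p -> po_le P p q -> G q;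
  filter_dir : forall p q, G p -> G q ->
    exists2 r, G r & po_le P r p /\ po_le P r q
}.

Definition generic (M : set V) (P : partial_order) (G : set V) : Prop :=
  filter_on P G /\
  forall D, dense P D -> definable1 M D -> exists2 p, G p & D p.

(** * Names and generic extensions *)

Inductive is_name (P : set V) (s : V) : Prop :=
| IsName of (forall x, x ∈ s -> exists t p, [/\ x = ⟨t, p⟩, is_name P t & P p]).

Definition names (M P : set V) : set V := [set s | M s /\ is_name P s].

Definition in_dom (t s : V) : Prop := exists p, ⟨t, p⟩ ∈ s.

Lemma in_dom_wf : well_founded in_dom.
Proof.
apply: (wf_incl _ _ _ _ (wf_clos_trans _ _ V_foundation)) => t s [p ts].
have step := @Relation_Operators.t_step V elem.
have trans := @Relation_Operators.t_trans V elem.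
apply: (trans _ ⟨t, p⟩); last exact: step.
apply: (trans _ (upair t t)); apply: (step).
- by rewrite in_upair; left.
- by rewrite in_upair; left.
Qed.

(** The recursion [evaluate G s = { evaluate G t | exists p in G, ⟨t, p⟩ ∈ s }],
   characterised by [in_evaluate]. *)
Definition evaluate_step (G : set V) (s : V) (rec : forall t, in_dom t s -> V) : V :=
  setof [set y | exists t (ts : in_dom t s),
                   (exists2 p, G p & ⟨t, p⟩ ∈ s) /\ y = rec t ts].

Definition evaluate (G : set V) : V -> V := Fix in_dom_wf (fun=> V) (@evaluate_step G).

Lemma evaluateE G s : evaluate G s =
  setof [set y | exists t, (exists2 p, G p & ⟨t, p⟩ ∈ s) /\ y = evaluate G t].
Proof.
rewrite [LHS]Fix_eq => [|u f g fg]; last first.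
  by congr evaluate_step; do 2![apply/functional_extensionality_dep => ?].
congr setof; apply/funext => y; apply/propext; split.
- by move=> [t [_ [tG ->]]]; exists t.
- move=> [t [[p Gp tp] ->]]; exists t, (ex_intro _ p tp).
  by split=> //; exists p.
Qed.

Lemma in_evaluate G s y :
  y ∈ evaluate G s <-> exists t p, [/\ G p, ⟨t, p⟩ ∈ s & y = evaluate G t].
Proof.
have C_small :
    small [set y | exists t, (exists2 p, G p & ⟨t, p⟩ ∈ s) /\ y = evaluate G t].
  pose R u v := exists t p, [/\ u = ⟨t, p⟩, G p & v = evaluate G t].
  have Rfun u v w : u ∈ s -> R u v -> R u w -> v = w.
    move=> _ [t [p [-> _ ->]]] [t' [p' [/opair_inj[tt' _] _ ->]]].
    by rewrite tt'.
  have [x xP] := V_replacement Rfun.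
  exists x => v; rewrite xP; split.
  - by move=> [u us [t [p [uE Gp ->]]]]; rewrite uE in us; exists t; split=> //; exists p.
  - move=> [t [[p Gp us] ->]]; exists ⟨t, p⟩ => //.
    by exists t, p.
rewrite evaluateE in_setof //; split=> [[t [[p Gp ts] ->]]|[t [p [Gp ts ->]]]].
- by exists t, p.
- by exists t; split=> //; exists p.
Qed.

Definition extension (M P G : set V) : set V := evaluate G @` names M P.

(** * The forcing relation *)

Definition forces (M : set V) (P : partial_order) n (f : formula n)
    (p : V) (s : n.-tuple V) : Prop :=
  forall G, generic M P G -> G p ->
    sat (extension M (po_dom P) G) f [tuple of map (evaluate G) s].

Definition definability_lemma (M : set V) (P : partial_order)
    n (f : formula n) : Prop :=
  definable M [set e : n.+1.-tuple V | exists (p : V) (s : n.-tuple V),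
    [/\ e = [tuple of p :: s], po_dom P p, tuple_in (names M (po_dom P)) s
      & forces M P f p s]].

Definition truth_lemma (M : set V) (P : partial_order)
    n (f : formula n) : Prop :=
  forall s : n.-tuple V, tuple_in (names M (po_dom P)) s ->
  forall G, generic M P G ->
    sat (extension M (po_dom P) G) f [tuple of map (evaluate G) s] ->
    exists2 p, G p & forces M P f p s.

Definition forcing_theorem (M : set V) (P : partial_order)
    n (f : formula n) : Prop :=
  definability_lemma M P f /\ truth_lemma M P f.

(* Main.v *)
(** Assume that forcing of [a = b] is definable (if instead forcing of [a ∈ b]
    is, note that [p] forces [a = b] if and only if it forces
    [a ∈ {⟨b, p⟩}]).  The names are then definable as well, since [a] is a name
    if and only if some condition forces [a = a].  The truth lemma for [a = b]
    is proved by induction on [a]: the conditions that either force [a = b], or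
    put into one of [a], [b] an element that they prevent from being equal to an
    element of the other, form a dense set which is definable by assumption, and
    the induction hypothesis excludes the second alternative in a generic filter
    with [a^G = b^G].  From the truth lemma for equality, [p] forces [a ∈ b] if
    and only if below [p] there are densely many [r] forcing [a = c] with
    [r <= s] for some [⟨c, s⟩ ∈ b].  The other formulas are handled by the usual
    recursion. *)

Require Import Defs.
From mathcomp Require Import all_boot.
From mathcomp Require Import boolp classical_sets functions cardinality.

Set Implicit Arguments.
Unset Strict Implicit.
Unset Printing Implicit Defensive.

Local Open Scope classical_set_scope.

(** * Tuples and renaming of variables in formulas *)

Lemma tnth_cons0 (T : Type) n (x : T) (e : n.-tuple T) :
  tnth [tuple of x :: e] ord0 = x.
Proof. by []. Qed.

Lemma tnth_consS (T : Type) n (x : T) (e : n.-tuple T) i :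
  tnth [tuple of x :: e] (lift ord0 i) = tnth e i.
Proof. by rewrite !(tnth_nth x). Qed.

Lemma mktuple_cons (T : Type) n (f : 'I_n.+1 -> T) :
  [tuple f i | i < n.+1] =
  [tuple of f ord0 :: [tuple f (lift ord0 i) | i < n]].
Proof.
apply: eq_from_tnth => i; rewrite tnth_mktuple.
case: (unliftP ord0 i) => [j|] ->; last by rewrite tnth_cons0.
by rewrite tnth_consS tnth_mktuple.
Qed.

Lemma cons_tuple_inj (T : Type) n (x y : T) (s w : n.-tuple T) :
  [tuple of x :: s] = [tuple of y :: w] -> x = y /\ s = w.
Proof. by move=> e; have [xy sw] := congr1 val e; split=> //; apply: val_inj. Qed.

Lemma mktuple_oapp (T E : Type) n (x : E -> T) (u : 'I_n -> E -> T) e :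
  [tuple oapp u x (unlift ord0 i) e | i < n.+1] =
  [tuple of x e :: [tuple u i e | i < n]].
Proof.
rewrite mktuple_cons unlift_none; congr [tuple of _ :: _].
by apply: eq_from_tnth => i; rewrite !tnth_mktuple liftK.
Qed.

Lemma mktuple_tnth (T : Type) n (e : n.-tuple T) : [tuple tnth e i | i < n] = e.
Proof. by apply: eq_from_tnth => i; rewrite tnth_mktuple. Qed.

(** The map on variables need not be injective: identifying variables lets one quantifier bind
    several of them at once. *)
Fixpoint rename n (f : formula n) : forall m, ('I_n -> 'I_m) -> formula m :=
  match f in formula n return forall m, ('I_n -> 'I_m) -> formula m with
  | FMem _ i j => fun _ h => FMem (h i) (h j)
  | FEq _ i j => fun _ h => FEq (h i) (h j)
  | FNeg _ g => fun _ h => FNeg (rename g h)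
  | FAnd _ g g' => fun _ h => FAnd (rename g h) (rename g' h)
  | FAll _ g => fun _ h =>
      FAll (rename g (fun i => if unlift ord0 i is Some j
                               then lift ord0 (h j) else ord0))
  end.

Lemma sat_rename A n (f : formula n) m (h : 'I_n -> 'I_m) e :
  sat A (rename f h) e <-> sat A f [tuple tnth e (h i) | i < n].
Proof.
elim: f m h e => {n} [n i j|n i j|n f IH|n f IHf g IHg|n f IH] m h e /=.
- by rewrite !tnth_mktuple.
- by rewrite !tnth_mktuple.
- by rewrite IH.
- by rewrite IHf IHg.
- suff eqe x : [tuple tnth [tuple of x :: e] (if unlift ord0 i is Some j
        then lift ord0 (h j) else ord0) | i < n.+1] =
      [tuple of x :: [tuple tnth e (h i) | i < n]].
    by split=> fx x /fx; rewrite IH eqe.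
  rewrite mktuple_cons unlift_none; congr [tuple of _ :: _].
  by apply: eq_from_tnth => i; rewrite !tnth_mktuple liftK tnth_consS.
Qed.

(** * Definability *)

(* Definability over [(M, ∈)] is handled through predicates on environments
   [nat -> V]: quantification over [x] in [M] turns a predicate of [x] and [e]
   into one of the environment listing [x, e 0, e 1, ...]. *)
Definition env_in (M : set V) (e : nat -> V) : Prop := forall i, M (e i).

Definition scons (x : V) (e : nat -> V) (i : nat) : V :=
  if i is j.+1 then e j else x.

(** Constants stand for parameters from [M], so that the closure properties below need not keep
    track of a list of parameters. *)
Definition term (M : set V) (t : (nat -> V) -> V) : Prop :=
  (exists i, t = fun e => e i) \/ (exists2 c, M c & t = fun=> c).

Definition definable_env (M : set V) (Q : (nat -> V) -> Prop) : Prop :=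
  exists n (f : formula n) (t : 'I_n -> (nat -> V) -> V),
    (forall i, term M (t i)) /\
    forall e, env_in M e -> (Q e <-> sat M f [tuple t i e | i < n]).

Section DefinableEnv.
Variable M : set V.
Implicit Types (t u : (nat -> V) -> V) (Q : (nat -> V) -> Prop).

Lemma term_var i : term M (fun e => e i).
Proof. by left; exists i. Qed.

Lemma term_const c : M c -> term M (fun=> c).
Proof. by right; exists c. Qed.

Lemma term_rename t (h : nat -> nat) :
  term M t -> term M (fun e => t (fun i => e (h i))).
Proof.
by move=> [[i ->]|[c Mc ->]]; [left; exists (h i)|right; exists c].
Qed.

Lemma term_in t e : term M t -> env_in M e -> M (t e).
Proof. by move=> [[i ->] Me|[c Mc ->]//]; apply: Me. Qed.

Lemma definable_env_ext Q Q' :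
  (forall e, env_in M e -> (Q' e <-> Q e)) ->
  definable_env M Q -> definable_env M Q'.
Proof.
move=> QQ' [n [f [t [tt ft]]]]; exists n, f, t; split=> // e Me.
by rewrite QQ' // ft.
Qed.

Lemma definable_env_mem t u :
  term M t -> term M u -> definable_env M (fun e => t e ∈ u e).
Proof.
move=> tt tu; exists 2, (FMem (ord0 : 'I_2) (ord_max : 'I_2)).
by exists (fun i => if i == ord0 then t else u); split=> [i|e _];
  [case: ifP|rewrite /= !tnth_mktuple].
Qed.

Lemma definable_env_eq t u :
  term M t -> term M u -> definable_env M (fun e => t e = u e).
Proof.
move=> tt tu; exists 2, (FEq (ord0 : 'I_2) (ord_max : 'I_2)).
by exists (fun i => if i == ord0 then t else u); split=> [i|e _];
  [case: ifP|rewrite /= !tnth_mktuple].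
Qed.

Lemma definable_env_neg Q :
  definable_env M Q -> definable_env M (fun e => ~ Q e).
Proof.
move=> [n [f [t [tt ft]]]]; exists n, (FNeg f), t; split=> // e Me /=.
by rewrite ft.
Qed.

Lemma definable_env_and Q Q' :
  definable_env M Q -> definable_env M Q' ->
  definable_env M (fun e => Q e /\ Q' e).
Proof.
move=> [n [f [t [tt ft]]]] [n' [f' [t' [tt' ft']]]].
exists (n + n'), (FAnd (rename f (lshift n')) (rename f' (@rshift n n'))).
exists (fun i => match fintype.split i with inl j => t j | inr j => t' j end).
split=> [i|e Me /=]; first by case: fintype.split.
rewrite !sat_rename ft // ft' //.
pose u i := match fintype.split i with inl j => t j | inr j => t' j end.
have -> : [tuple t i e | i < n] =
    [tuple tnth [tuple u i e | i < n + n'] (lshift n' i) | i < n].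
  by apply: eq_from_tnth => i; rewrite !tnth_mktuple /u (unsplitK (inl i)).
have -> // : [tuple t' i e | i < n'] =
    [tuple tnth [tuple u i e | i < n + n'] (rshift n i) | i < n'].
by apply: eq_from_tnth => i; rewrite !tnth_mktuple /u (unsplitK (inr i)).
Qed.

Lemma definable_env_all (Q : V -> (nat -> V) -> Prop) :
  definable_env M (fun e => Q (e 0) (fun i => e i.+1)) ->
  definable_env M (fun e => forall x, M x -> Q x e).
Proof.
move=> [n [f [t [tt ft]]]].
(* The Boolean records whether [t i] is the variable about to be quantified. The second component is
   the term left after shifting the other variables down; in the quantified case [e 0] merely fills
   the slot. *)
have /choice[u uP] i : exists u : bool * ((nat -> V) -> V), term M u.2 /\
    forall x e, t i (scons x e) = if u.1 then x else u.2 e.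
  have [[[|j] ->]|[c Mc ->]] := tt i.
  - by exists (true, fun e => e 0); split=> //; apply: term_var.
  - by exists (false, fun e => e j); split=> //; apply: term_var.
  - by exists (false, fun=> c); split=> //; apply: term_const.
pose h (i : 'I_n) := if (u i).1 then ord0 else lift ord0 i.
exists n, (FAll (rename f h)), (fun i => (u i).2); split=> [i|e Me /=].
  by case: (uP i).
suff eqQ x : M x -> (Q x e <-> sat M (rename f h)
    [tuple of x :: [tuple (u i).2 e | i < n]]) by split=> H x Mx; apply/eqQ/H.
move=> Mx; have Mxe : env_in M (scons x e) by case.
rewrite sat_rename -[Q x e]/(Q (scons x e 0) (fun i => scons x e i.+1)) ft //.
rewrite (_ : mktuple (fun i => t i _) = mktuple
    (fun i => tnth [tuple of x :: [tuple (u i).2 e | i < n]] (h i))) //.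
apply: eq_from_tnth => i; rewrite !tnth_mktuple (uP i).2 /h.
by case: ifP; rewrite ?tnth_cons0 ?tnth_consS ?tnth_mktuple.
Qed.

Lemma definable_env_or Q Q' :
  definable_env M Q -> definable_env M Q' ->
  definable_env M (fun e => Q e \/ Q' e).
Proof.
move=> dQ dQ'; apply: (@definable_env_ext (fun e => ~ (~ Q e /\ ~ Q' e))).
  by move=> e _; rewrite not_andP !notK.
by apply: definable_env_neg; apply: definable_env_and; apply: definable_env_neg.
Qed.

Lemma definable_env_imp Q Q' :
  definable_env M Q -> definable_env M Q' ->
  definable_env M (fun e => Q e -> Q' e).
Proof.
move=> dQ dQ'; apply: (@definable_env_ext (fun e => ~ Q e \/ Q' e)).
  by move=> e _; rewrite -implyE.
exact/definable_env_or/dQ'/definable_env_neg.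
Qed.

Lemma definable_env_iff Q Q' :
  definable_env M Q -> definable_env M Q' ->
  definable_env M (fun e => Q e <-> Q' e).
Proof. by move=> dQ dQ'; apply: definable_env_and; apply: definable_env_imp. Qed.

Lemma definable_env_ex (Q : V -> (nat -> V) -> Prop) :
  definable_env M (fun e => Q (e 0) (fun i => e i.+1)) ->
  definable_env M (fun e => exists2 x, M x & Q x e).
Proof.
move=> dQ; apply: (@definable_env_ext (fun e => ~ forall x, M x -> ~ Q x e)).
  move=> e _; split=> [[x Mx Qx]|/existsNP[x /not_implyP[Mx /contrapT Qx]]].
    by move=> /(_ x Mx).
  by exists x.
exact/definable_env_neg/definable_env_all/definable_env_neg.
Qed.

Lemma definable_env_definable n (R : set (n.-tuple V))
    (t : 'I_n -> (nat -> V) -> V) :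
  definable M R -> (forall i, term M (t i)) ->
  definable_env M (fun e => R [tuple t i e | i < n]).
Proof.
move=> [k [f [a [Ma Rf]]]] tt; exists (n + k), f.
exists (fun i =>
  match fintype.split i with inl j => t j | inr j => fun=> tnth a j end).
split=> [i|e Me]; first by case: fintype.split => // j; apply/term_const/Ma.
rewrite Rf; set s := (X in sat M f X); set s' := (X in _ <-> sat M f X).
have -> : s = s'.
  apply: eq_from_tnth => i; rewrite -[i]fintype.splitK tnth_mktuple unsplitK.
  case: (fintype.split i) => j /=; first by rewrite tnth_lshift tnth_mktuple.
  by rewrite tnth_rshift.
split=> [[] //|?]; split=> // i; rewrite tnth_mktuple; exact: term_in.
Qed.

Lemma definable_of_env n (R : set (n.-tuple V)) Q :
  M !=set0 -> definable_env M Q -> (forall s, R s -> tuple_in M s) ->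
  (forall e, env_in M e -> (R [tuple e (val i) | i < n] <-> Q e)) ->
  definable M R.
Proof.
move=> [d Md] [m [f [t [tt ft]]]] RM RQ.
(* Constants become parameters, with one slot for each variable of [f]. A variable of index at least
   [n] reads the default [d] in [nth d s], so it becomes a parameter with value [d]. *)
have /choice[u uP] i : exists u : 'I_(n + m) * V, M u.2 /\
    forall a : m.-tuple V, tnth a i = u.2 ->
    forall s : n.-tuple V, t i (nth d s) = tnth [tuple of s ++ a] u.1.
  have [[j ->]|[c Mc ->]] := tt i; last first.
    exists (rshift n i, c); split=> // a ai s.
    by rewrite tnth_rshift ai.
  have [jn|nj] := ltnP j n.
    exists (lshift m (Ordinal jn), d); split=> // a ai s.
    by rewrite tnth_lshift (tnth_nth d).
  exists (rshift n i, d); split=> // a ai s.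
  by rewrite tnth_rshift ai nth_default // size_tuple.
exists m, (rename f (fun i => (u i).1)), [tuple (u i).2 | i < m].
split=> [i|s]; first by rewrite tnth_mktuple; case: (uP i).
suff RE : tuple_in M s -> (R s <-> sat M (rename f (fun i => (u i).1))
    [tuple of s ++ [tuple (u i).2 | i < m]]).
  by split=> [Rs|[/RE sRE /sRE//]]; split; [|apply/RE => //]; apply: RM.
move=> Ms; have Me : env_in M (nth d s).
  move=> i; have [lt_in|le_ni] := ltnP i n; last first.
    by rewrite nth_default ?size_tuple.
  by rewrite -[i]/(val (Ordinal lt_in)) -tnth_nth.
have {1}-> : s = [tuple nth d s (val i) | i < n].
  by apply: eq_from_tnth => i; rewrite tnth_mktuple (tnth_nth d).
rewrite RQ // ft // sat_rename.
rewrite (_ : mktuple _ = mktuple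
    (fun i => tnth [tuple of s ++ [tuple (u i).2 | i < m]] (u i).1)) //.
apply: eq_from_tnth => i; rewrite !tnth_mktuple.
by apply: (uP i).2; rewrite tnth_mktuple.
Qed.

End DefinableEnv.

(** * Enumeration of the definable classes and existence of generic filters *)

Fixpoint formula_code n (f : formula n) : GenTree.tree nat :=
  match f with
  | FMem _ i j => GenTree.Node 0 [:: GenTree.Leaf (val i); GenTree.Leaf (val j)]
  | FEq _ i j => GenTree.Node 1 [:: GenTree.Leaf (val i); GenTree.Leaf (val j)]
  | FNeg _ g => GenTree.Node 2 [:: formula_code g]
  | FAnd _ g h => GenTree.Node 3 [:: formula_code g; formula_code h]
  | FAll _ g => GenTree.Node 4 [:: formula_code g]
  end.

(** Codes do not record the number of free variables, so it is an argument, against which [insub]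
    checks each index. *)
Fixpoint formula_decode (c : GenTree.tree nat) n : option (formula n) :=
  match c with
  | GenTree.Node 0 [:: GenTree.Leaf i; GenTree.Leaf j] =>
      if (insub i, insub j) is (Some i', Some j') then Some (FMem i' j') else None
  | GenTree.Node 1 [:: GenTree.Leaf i; GenTree.Leaf j] =>
      if (insub i, insub j) is (Some i', Some j') then Some (FEq i' j') else None
  | GenTree.Node 2 [:: c1] => omap (@FNeg n) (formula_decode c1 n)
  | GenTree.Node 3 [:: c1; c2] =>
      if (formula_decode c1 n, formula_decode c2 n) is (Some g, Some h)
      then Some (FAnd g h) else None
  | GenTree.Node 4 [:: c1] => omap (@FAll n) (formula_decode c1 n.+1)
  | _ => None
  end.

Lemma formula_codeK n (f : formula n) :
  formula_decode (formula_code f) n = Some f.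
Proof.
by elim: f => {n} [n i j|n i j|n f /= ->|n f /= -> g ->|n f /= ->] //=;
  rewrite !valK.
Qed.

(** A definable class is determined by a number of parameters, a formula code and the positions of
    the parameters in an enumeration of [M]; there are countably many such triples. *)
Lemma definable1_enumeration (M : set V) : countable M ->
  exists D : nat -> set V, forall C, definable1 M C -> exists i, D i = C.
Proof.
move=> cM; have [g gM] : exists g : nat -> V, forall x, M x -> exists i, g i = x.
  move: cM => /pfcard_geP[->|[g]]; first by exists (fun=> vfamily (of_void V)).
  by exists g => x Mx; have [i _ <-] := @surj _ _ _ _ g x Mx; exists i.
pose T := (nat * GenTree.tree nat * seq nat)%type.
exists (fun i => if (unpickle i : option T) is Some (k, c, s) then
  if formula_decode c (1 + k) is Some f then
    [set x | tuple_in M [tuple x] /\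
      sat M f [tuple of [tuple x] ++ [tuple g (nth 0 s j) | j < k]]]
  else set0 else set0).
move=> C [k [f [a [Ma fC]]]].
have /choice[h hP] j : exists i, g i = tnth a j by apply: gM.
have ga : [tuple g (nth 0 [seq h j | j : 'I_k] j) | j < k] = a.
  apply: eq_from_tnth => j; rewrite tnth_mktuple -hP.
  by rewrite (nth_map j) ?size_enum_ord // nth_ord_enum.
exists (pickle ((k, formula_code f, [seq h j | j : 'I_k]) : T)).
rewrite pickleK formula_codeK ga; apply/funext => x; apply/propext.
by rewrite -[C x]/([set e : 1.-tuple V | C (tnth e ord0)] [tuple x]) fC.
Qed.

(** The Rasiowa-Sikorski argument: a descending sequence from [p] enters the definable dense classes
    one after the other, and its upward closure is the filter. *)
Lemma generic_exists M P p : countable M -> po_dom P p ->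
  exists2 G, generic M P G & G p.
Proof.
move=> /definable1_enumeration[D D_all] Pp.
have /choice[next nextP] (iq : nat * V) : exists r, po_dom P iq.2 ->
    po_le P r iq.2 /\ (dense P (D iq.1) -> D iq.1 r).
  case: iq => i q /=; have [dD|nD] := pselect (dense P (D i)); last first.
    by exists q => Pq; split=> //; apply: po_le_refl.
  have [Pq|nq] := pselect (po_dom P q); last by exists q.
  by have [r Dr rq] := dD.2 q Pq; exists r.
pose x := fix x i := if i is j.+1 then next (j, x j) else p.
have Px i : po_dom P (x i).
  by elim: i => //= i /(nextP (i, x i))[/po_le_dom[]].
have x_le i j : i <= j -> po_le P (x j) (x i).
  elim: j => [|j IH]; first by rewrite leqn0 => /eqP->; apply: po_le_refl.
  rewrite leq_eqVlt => /orP[/eqP->|/IH xji]; first exact: po_le_refl.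
  by apply: po_le_trans xji; case: (nextP (j, x j) (Px j)).
exists [set q | exists i, po_le P (x i) q]; last by exists 0; apply: po_le_refl.
split; [split|].
- by move=> q [i /po_le_dom[]].
- by exists p, 0; apply: po_le_refl.
- by move=> q r [i xq] qr; exists i; apply: po_le_trans qr.
- move=> q r [i xq] [j xr]; exists (x (maxn i j)).
    by exists (maxn i j); apply: po_le_refl.
  by split; [apply: po_le_trans xq|apply: po_le_trans xr];
    apply: x_le; rewrite ?leq_maxl ?leq_maxr.
- move=> C dC /D_all[i DC]; exists (x i.+1).
    by exists i.+1; apply: po_le_refl.
  by rewrite -DC; apply: (nextP (i, x i) (Px i)).2; rewrite /= DC.
Qed.

(** * Automation of definability proofs *)

Ltac prove_term :=
  first [exact: term_var | solve [apply: term_const; assumption] | assumption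
        | solve [apply: term_rename; auto]
        | solve [move=> ?; apply: term_rename; auto]].

(** Hypotheses are tried before connectives, so that a conjunction already known to be definable is
    used whole instead of being split. *)
Ltac prove_definable_with tac :=
  repeat (first
    [ prove_term | tac | match goal with H : _ |- _ => apply: H end
    | apply: definable_env_all | apply: definable_env_ex
    | apply: definable_env_neg | apply: definable_env_iff
    | apply: definable_env_and | apply: definable_env_or
    | apply: definable_env_imp
    | apply: definable_env_mem; [prove_term|prove_term]
    | apply: definable_env_eq; [prove_term|prove_term] ]; cbv beta).

(** * Forcing over a countable transitive model *)

Section Forcing.
Variables (M : set V) (P : partial_order).
Hypotheses (hM : ctm_ZFminus M) (hP : definable_order M P).
Implicit Types (t u v : (nat -> V) -> V) (p q r : V) (G : set V).

Notation N := (names M (po_dom P)).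

Lemma ctm_nonempty : M !=set0.
Proof. by have [w Mw _] := ZFm_infinity (ctm_models hM); exists w. Qed.

Lemma ctm_elem x y : y ∈ x -> M x -> M y.
Proof. by move=> yx Mx; apply: (ctm_transitive hM) yx. Qed.

Lemma ctm_upair x y : M x -> M y -> M (upair x y).
Proof.
move=> Mx My; have [u Mu uP] := ZFm_pairing (ctm_models hM) Mx My.
suff -> : upair x y = u by [].
apply: V_extensionality => z; rewrite in_upair; split=> [|zu].
  by move=> zxy; apply/uP => //; case: zxy => ->.
by apply/uP => //; apply: ctm_elem zu Mu.
Qed.

Lemma ctm_opair x y : M x -> M y -> M ⟨x, y⟩.
Proof. by move=> Mx My; do 2?apply: ctm_upair. Qed.

Lemma ctm_of_opair x y : M ⟨x, y⟩ -> M x /\ M y.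
Proof.
move=> Mxy; have Mu : M (upair x y).
  by apply: ctm_elem Mxy; rewrite in_upair; right.
by split; apply: ctm_elem Mu; rewrite in_upair; [left|right].
Qed.

Lemma po_dom_in p : po_dom P p -> M p.
Proof.
case: hP => -[k [f [a [_ fP]]]] _ Pp.
by have [/(_ ord0)] := (fP [tuple p]).1 Pp.
Qed.

Lemma po_leMl p q : po_le P p q -> M p.
Proof. by move=> /po_le_dom[/po_dom_in]. Qed.

Lemma definable_env_dom t : term M t -> definable_env M (fun e => po_dom P (t e)).
Proof.
move=> tt; apply: definable_env_ext
  (definable_env_definable (t := fun=> t) hP.1 (fun=> tt)) => e _ /=.
by rewrite tnth_mktuple.
Qed.

Lemma definable_env_le t u : term M t -> term M u ->
  definable_env M (fun e => po_le P (t e) (u e)).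
Proof.
move=> tt tu; have tut (i : 'I_2) : term M (if i == ord0 then t else u).
  by case: ifP.
apply: definable_env_ext (definable_env_definable hP.2 tut) => e _ /=.
by rewrite !tnth_mktuple.
Qed.

(** By transitivity all the sets involved have their elements in [M], so equality can be tested with
    a quantifier over [M]. *)
Lemma definable_env_upair t u v : term M t -> term M u -> term M v ->
  definable_env M (fun e => t e = upair (u e) (v e)).
Proof.
move=> tt tu tv; apply: (@definable_env_ext _
  (fun e => forall x, M x -> (x ∈ t e <-> x = u e \/ x = v e))).
  move=> e Me; split=> [-> x _|tuv]; first exact: in_upair.
  apply: V_extensionality => x; rewrite in_upair; split=> [xt|xuv].
    by apply/tuv => //; apply: (ctm_elem xt); apply: term_in tt Me.
  by apply/tuv => //; case: xuv => ->;
      [apply: term_in tu Me|apply: term_in tv Me].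
by prove_definable_with fail.
Qed.

Lemma definable_env_opair t u v : term M t -> term M u -> term M v ->
  definable_env M (fun e => t e = ⟨u e, v e⟩).
Proof.
move=> tt tu tv; apply: (@definable_env_ext _ (fun e => exists2 x, M x &
  x = upair (u e) (u e) /\ exists2 y, M y &
  y = upair (u e) (v e) /\ t e = upair x y)).
  move=> e Me; have [Mu Mv] := (term_in tu Me, term_in tv Me).
  split=> [->|[x _ [-> [y _ [-> ->]]]]//].
  exists (upair (u e) (u e)); first exact: ctm_upair.
  by split=> //; exists (upair (u e) (v e)); first exact: ctm_upair.
by prove_definable_with ltac:(apply: definable_env_upair).
Qed.

Lemma definable_env_in_opair t u v : term M t -> term M u -> term M v ->
  definable_env M (fun e => ⟨u e, v e⟩ ∈ t e).
Proof.
move=> tt tu tv; apply: (@definable_env_ext _ (fun e => exists2 x, M x &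
  x = ⟨u e, v e⟩ /\ x ∈ t e)).
  move=> e Me; split=> [uvt|[x _ [->]]//]; exists ⟨u e, v e⟩ => //.
  by apply: (ctm_elem uvt); apply: term_in tt Me.
by prove_definable_with ltac:(apply: definable_env_opair).
Qed.

Ltac prove_definable := prove_definable_with ltac:(first
  [ apply: definable_env_dom | apply: definable_env_le
  | apply: definable_env_in_opair | apply: definable_env_opair
  | apply: definable_env_upair ]).

Lemma definable_env_tuple_in (A : set V) n (u : 'I_n -> (nat -> V) -> V) :
  (forall t, term M t -> definable_env M (fun e => A (t e))) ->
  (forall i, term M (u i)) ->
  definable_env M (fun e => tuple_in A [tuple u i e | i < n]).
Proof.
move=> dA; elim: n u => [|n IH] u tu.
  apply: (@definable_env_ext _ (fun e => e 0 = e 0)) => [e _|].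
    by split=> // _ [].
  by prove_definable_with fail.
apply: (@definable_env_ext _ (fun e => A (u ord0 e) /\
  tuple_in A [tuple u (lift ord0 i) e | i < n])); last first.
  by apply: definable_env_and; [apply: dA|apply: (IH (fun i => u (lift ord0 i)))].
move=> e _; split=> [Au|[A0 Au] i].
  split=> [|i]; first by have := Au ord0; rewrite tnth_mktuple.
  by have := Au (lift ord0 i); rewrite !tnth_mktuple.
rewrite tnth_mktuple; case: (unliftP ord0 i) => [j|] -> //.
by have := Au j; rewrite tnth_mktuple.
Qed.

Lemma definable_po_subset (D : set V) :
  D `<=` po_dom P -> definable_env M (fun e => D (e 0)) -> definable1 M D.
Proof.
move=> DP dD; apply: (definable_of_env ctm_nonempty dD) => [s Ds i|e Me /=].
  by rewrite ord1; apply/po_dom_in/DP.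
by rewrite tnth_mktuple.
Qed.

Lemma names_in_dom a b p : N a -> ⟨b, p⟩ ∈ a -> N b /\ po_dom P p.
Proof.
move=> [Ma [/(_ ⟨b, p⟩)aP]] ba.
have [c [q [/opair_inj[<- <-] Nb Pp]]] := aP ba.
by split=> //; split=> //; case: (ctm_of_opair (ctm_elem ba Ma)).
Qed.

Lemma names_in a : N a -> M a. Proof. by case. Qed.

(** Adding to [D] the conditions incompatible with [p] turns density below [p] into density in the
    whole order, and [G] contains none of these since it is directed. *)
Lemma generic_meets G p (D : set V) : generic M P G -> G p ->
  D `<=` po_dom P -> definable_env M (fun e => D (e 0)) ->
  (forall q, po_le P q p -> exists2 r, D r & po_le P r q) ->
  exists2 r, G r & D r.
Proof.
move=> [fG genG] Gp DP defD densD.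
have Mp := po_dom_in (filter_sub fG Gp).
pose D' : set V := [set r | po_dom P r /\ (D r \/
  ~ exists2 s, M s & po_le P s r /\ po_le P s p)].
have D'P : D' `<=` po_dom P by move=> r [].
have [||r Gr [_ [Dr|npr]]] := genG D'; last 2 first.
- by exists r.
- have [s Gs [sr sp]] := filter_dir fG Gr Gp; case: npr; exists s => //.
  exact: po_leMl sr.
- split=> // q Pq; have [[s _ [sq sp]]|npq] :=
    pselect (exists2 s, M s & po_le P s q /\ po_le P s p); last first.
    by exists q; [split=> //; right|apply: po_le_refl].
  have [r Dr rs] := densD s sp; exists r; last exact: po_le_trans sq.
  by split; [apply: DP|left].
- apply: definable_po_subset => //; rewrite /D' /=.
  by prove_definable.
Qed.

(** * Forcing of classes of generic filters *)

(* A sentence of the forcing language is abstracted to the class [phi] of the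
   filters [G] such that it holds in [M[G]]. *)
Definition forced (phi : set V -> Prop) (p : V) : Prop :=
  forall G, generic M P G -> G p -> phi G.

Definition truth (phi : set V -> Prop) : Prop :=
  forall G, generic M P G -> phi G -> exists2 p, G p & forced phi p.

Lemma forced_le phi p q : po_le P q p -> forced phi p -> forced phi q.
Proof.
by move=> qp fp G genG Gq; apply: fp => //; exact: (filter_up genG.1 Gq qp).
Qed.

(** One direction takes a generic filter through [q]; the other takes a condition forcing [phi] from
    the truth lemma and a common extension with [p]. Forcing a negation thus becomes first order in
    forcing [phi]. *)
Lemma forced_neg phi p : truth phi -> po_dom P p ->
  (forced (fun G => ~ phi G) p <-> forall q, po_le P q p -> ~ forced phi q).
Proof.
move=> tphi Pp; split=> [fp q qp fq|nf G genG Gp /(tphi _ genG)[q Gq fq]].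
  have [G genG Gq] := generic_exists (ctm_countable hM) (po_le_dom qp).1.
  by apply: (fp G) => //; [exact: (filter_up genG.1 Gq qp)|apply: fq].
have [r Gr [rp rq]] := filter_dir genG.1 Gp Gq.
exact: nf rp (forced_le rq fq).
Qed.

Lemma truth_neg phi : truth phi ->
  (forall t, term M t ->
    definable_env M (fun e => po_dom P (t e) /\ forced phi (t e))) ->
  truth (fun G => ~ phi G).
Proof.
move=> tphi dphi G genG nphi; have [p Gp] := filter_nonempty genG.1.
(* The conditions that decide [phi]; one in [G] cannot force [phi], which fails at [G]. *)
pose D : set V := [set p | po_dom P p /\ ((po_dom P p /\ forced phi p) \/
  forall q, M q -> po_le P q p -> ~ (po_dom P q /\ forced phi q))].
have [||q qp|r Gr [Pr [[_ fr]|nfr]]] := generic_meets (D := D) genG Gp.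
- by move=> q [].
- by rewrite /D /=; prove_definable.
- have Pq := (po_le_dom qp).1.
  have [[r rq fr]|nq] := pselect (exists2 r, po_le P r q & forced phi r).
    by have Pr := (po_le_dom rq).1; exists r => //; split=> //; left.
  exists q; last exact: po_le_refl.
  split=> //; right=> r _ rq [_ fr].
  by apply: nq; exists r.
- by have := fr G genG Gr.
- exists r => //; apply/forced_neg => // q qr fq.
  by apply: (nfr q (po_leMl qr) qr); split=> //; exact: (po_le_dom qr).1.
Qed.

Lemma truth_and phi psi : truth phi -> truth psi ->
  truth (fun G => phi G /\ psi G).
Proof.
move=> tphi tpsi G genG [/(tphi G genG)[p Gp fp] /(tpsi G genG)[q Gq fq]].
have [r Gr [rp rq]] := filter_dir genG.1 Gp Gq; exists r => // H genH Hr.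
by split; [apply: (forced_le rp fp)|apply: (forced_le rq fq)].
Qed.

Lemma truth_all (phi : V -> set V -> Prop) :
  (forall x, N x -> truth (phi x)) ->
  (forall t u, term M t -> term M u -> definable_env M
    (fun e => po_dom P (t e) /\ N (u e) /\ forced (phi (u e)) (t e))) ->
  (forall t, term M t -> definable_env M (fun e => N (t e))) ->
  truth (fun G => forall x, N x -> phi x G).
Proof.
move=> tphi dphi dN G genG allphi; have [p Gp] := filter_nonempty genG.1.
pose F x p := po_dom P p /\ N x /\ forced (phi x) p.
(* Either every instance is forced, or some name has an instance that no extension forces; the truth
   lemma for that instance excludes the latter in [G]. *)
pose D : set V := [set p | po_dom P p /\
  ((forall x, M x -> N x -> F x p) \/ exists2 x, M x & N x /\
    forall q, M q -> po_le P q p -> ~ F x q)].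
have [||q qp|r Gr [Pr [fr|[x _ [Nx nfr]]]]] := generic_meets (D := D) genG Gp.
- by move=> q [].
- by rewrite /D /=; prove_definable.
- have Pq := (po_le_dom qp).1; have [[r rq [x Nx nfr]]|nq] := pselect
    (exists2 r, po_le P r q & exists2 x, N x & forall s, po_le P s r -> ~ F x s).
    exists r => //; split; first exact: (po_le_dom rq).1.
    by right; exists x; [apply: names_in|split=> // s _; apply: nfr].
  exists q; last exact: po_le_refl.
  split=> //; left=> x Mx Nx; split=> //; split=> // H genH Hq.
  (* As no extension of [q] rules out forcing [phi x] below it, the conditions forcing [phi x] are
     dense below [q], and [H] contains one. *)
  have [||r rq|r Hr [_ [_ fr]]] := generic_meets (D := F x) genH Hq.
  + by move=> r [].
  + by apply: dphi; [apply: term_var|apply: term_const].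
  + apply: contrapT => nr; apply: nq; exists r => //; exists x => // s sr Fs.
    by apply: nr; exists s.
  + exact: fr.
- exists r => // H genH Hr x Nx; have [_ [_ fxr]] := fr x (names_in Nx) Nx.
  exact: fxr.
- have [q Gq fq] := tphi x Nx G genG (allphi x Nx).
  have [s Gs [sq sr]] := filter_dir genG.1 Gq Gr.
  have /nfr[] := sr; first exact: po_leMl sr.
  by split; [exact: (po_le_dom sr).1|split=> //; apply: forced_le sq fq].
Qed.

(** * Equality and membership *)

Definition forces_eq p a b : Prop :=
  po_dom P p /\ N a /\ N b /\ forced (fun G => evaluate G a = evaluate G b) p.

Definition forces_mem p a b : Prop :=
  po_dom P p /\ N a /\ N b /\ forced (fun G => evaluate G a ∈ evaluate G b) p.

Definition definable3 (R : V -> V -> V -> Prop) : Prop :=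
  forall t u v, term M t -> term M u -> term M v ->
    definable_env M (fun e => R (t e) (u e) (v e)).

(* [p] forces [a = b] if and only if it forces [a ∈ {⟨b, p⟩}]. *)
Lemma definable_eq_of_mem : definable3 forces_mem -> definable3 forces_eq.
Proof.
move=> dmem t u v tt tu tv.
(* For [p] in [G] this name evaluates to the singleton of the value of [b]. *)
pose sing p b := upair ⟨b, p⟩ ⟨b, p⟩.
have in_sing G p b y : G p -> (y ∈ evaluate G (sing p b) <-> y = evaluate G b).
  move=> Gp; rewrite in_evaluate; split=> [[c [q [_ cq ->]]]|->].
    by move: cq; rewrite in_upair; case=> /opair_inj[->].
  by exists b, p; split=> //; rewrite in_upair; left.
apply: (@definable_env_ext _ (fun e => exists2 c, M c & exists2 d, M d &
  c = ⟨v e, t e⟩ /\ d = upair c c /\ forces_mem (t e) (u e) d)).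
  move=> e Me; split.
  - move=> [Pp [Na [Nb eqab]]].
    have Mc : M ⟨v e, t e⟩.
      by apply: ctm_opair; [apply: term_in tv Me|apply: term_in tt Me].
    exists ⟨v e, t e⟩ => //; exists (sing (t e) (v e)); first exact: ctm_upair.
    split=> //; split=> //; split=> //; split=> //; split.
      split; first exact: ctm_upair.
      split=> x; rewrite in_upair => xE; exists (v e), (t e).
      by split=> //; [case: xE|case: Nb].
    by move=> G genG Gp; apply/in_sing => //; apply: eqab.
  - move=> [c _ [d _ [-> [-> [Pp [Na [Nd mab]]]]]]].
    have [|Nb _] := @names_in_dom _ (v e) (t e) Nd.
      by rewrite in_upair; left.
    by split=> //; split=> //; split=> // G genG Gp; apply/in_sing/mab.
by prove_definable.
Qed.

(** Being a name is an inductive condition; reading it off the forcing relation, with a fixed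
    condition as parameter, avoids formalizing the induction in [M]. *)
Lemma definable_names : definable3 forces_eq -> po_dom P !=set0 ->
  forall t, term M t -> definable_env M (fun e => N (t e)).
Proof.
move=> deq [p Pp] t tt.
apply: (@definable_env_ext _ (fun e => forces_eq p (t e) (t e))).
  by move=> e _; split=> [Nt|[_ []]//]; split=> //; split.
by apply: deq => //; apply/term_const/po_dom_in.
Qed.

(** An obstruction to the inclusion of [a] in [b]. All quantifiers range over [M], so it is
    definable as soon as [forces_eq] is. *)
Definition unmatched p a b : Prop :=
  exists2 c, M c & exists2 r, M r & ⟨c, r⟩ ∈ a /\ po_le P p r /\
    forall d, M d -> forall s, M s -> forall q, M q ->
      ⟨d, s⟩ ∈ b -> po_le P q p -> po_le P q s -> ~ forces_eq q c d.

(** Given [⟨c, r⟩] in [a] with [r] in [G], a condition below [p] and [r] with no extension matching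
    [c] to an element of [b] would itself be unmatched. So the matching conditions are dense there,
    and [G] meets them. *)
Lemma forced_sub p a b : definable3 forces_eq -> N a -> N b ->
  (forall q, po_le P q p -> ~ unmatched q a b) ->
  forced (fun G => forall x, x ∈ evaluate G a -> x ∈ evaluate G b) p.
Proof.
move=> deq Na Nb nun G genG Gp x /in_evaluate[c [r [Gr ca ->]]].
have [Nc Pr] := names_in_dom Na ca.
have [r' Gr' [r'p r'r]] := filter_dir genG.1 Gp Gr.
pose D : set V := [set q | po_dom P q /\ exists2 d, M d & exists2 s, M s &
  ⟨d, s⟩ ∈ b /\ po_le P q s /\ forces_eq q c d].
have [||q qr'|q Gq [_ [d _ [s _ [db [qs [_ [_ [_ cd]]]]]]]]] :=
  generic_meets (D := D) genG Gr'.
- by move=> q [].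
- have tc := term_const (names_in Nc); have tb := term_const (names_in Nb).
  by rewrite /D /=; prove_definable.
- apply: contrapT => nq; have qp := po_le_trans qr' r'p.
  apply: (nun q qp); exists c; first exact: names_in.
  exists r; first exact: po_dom_in; split=> //; split.
    exact: po_le_trans r'r.
  move=> d Md s Ms q' Mq' db q'q q's cd; apply: nq; exists q' => //.
  split; first exact: (po_le_dom q'q).1.
  by exists d => //; exists s.
- apply/in_evaluate; exists d, s; split=> //; last exact: cd.
  exact: (filter_up genG.1 Gq qs).
Qed.

Lemma truth_eq a b : definable3 forces_eq -> N a -> N b ->
  truth (fun G => evaluate G a = evaluate G b).
Proof.
move=> deq; elim/(well_founded_ind in_dom_wf): a b => a IH b Na Nb G genG eqab.
have [p Gp] := filter_nonempty genG.1.
pose D : set V := [set p | po_dom P p /\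
  (forces_eq p a b \/ unmatched p a b \/ unmatched p b a)].
(* The value of an unmatched [c] still equals that of some [d] in [y], and some [q] in [G] forces
   this; a common extension of [r], [q] and the condition attached to [d] gives the contradiction.
   General [x] and [y] serve for both orders of [a] and [b]. *)
have contra x y r : G r -> N x -> N y -> evaluate G x = evaluate G y ->
    (forall c d, in_dom c x -> in_dom d y -> N c -> N d ->
      evaluate G c = evaluate G d -> exists2 q, G q & forces_eq q c d) ->
    ~ unmatched r x y.
  move=> Gr Nx Ny xy tcd [c _ [s _ [cx [rs nr]]]].
  have [Nc Ps] := names_in_dom Nx cx.
  have : evaluate G c ∈ evaluate G y.
    rewrite -xy in_evaluate; exists c, s; split=> //.
    exact: (filter_up genG.1 Gr rs).
  rewrite in_evaluate => -[d [s' [Gs' dy cd]]].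
  have [Nd Ps'] := names_in_dom Ny dy.
  have [||q Gq [_ [_ [_ fq]]]] := tcd c d _ _ Nc Nd cd; [by exists s|by exists s'|].
  have [q1 Gq1 [q1r q1s']] := filter_dir genG.1 Gr Gs'.
  have [q2 Gq2 [q2q1 q2q]] := filter_dir genG.1 Gq1 Gq.
  have q2r := po_le_trans q2q1 q1r.
  apply: (nr d (names_in Nd) s' (po_dom_in Ps') q2 (po_leMl q2r) dy q2r).
    exact: po_le_trans q1s'.
  split; first exact: (po_le_dom q2r).1.
  by split=> //; split=> //; apply: forced_le fq.
have tcd c d : in_dom c a -> N c -> N d -> evaluate G c = evaluate G d ->
    exists2 q, G q & forces_eq q c d.
  move=> ca Nc Nd /(IH c ca d Nc Nd G genG)[q Gq fq]; exists q => //.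
  by split; [exact: (filter_sub genG.1 Gq)|split=> //; split].
have [||q qp|r Gr [_ [[_ [_ [_ fr]]]|[]]]] := generic_meets (D := D) genG Gp.
- by move=> q [].
- have ta := term_const (names_in Na); have tb := term_const (names_in Nb).
  by rewrite /D /=; prove_definable.
(* If no extension of [q] is unmatched on either side, then [q] forces both inclusions, hence the
   equality. *)
- have Pq := (po_le_dom qp).1; apply: contrapT => nq; apply: (nq).
  exists q; last exact: po_le_refl.
  split=> //; left; split=> //; split=> //; split=> // H genH Hq.
  apply: V_extensionality => x; split.
    apply: (forced_sub (p := q)) => // r rq un; apply: nq; exists r => //.
    by split; [exact: (po_le_dom rq).1|right; left].
  apply: (forced_sub (p := q)) => // r rq un; apply: nq; exists r => //.
  by split; [exact: (po_le_dom rq).1|right; right].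
- by exists r.
- by move=> /contra[] // c d ca _; apply: tcd.
(* The induction hypothesis takes elements of [a] on the left only, so the equality is reversed
   before and after using it. *)
- move=> /contra[] // d c _ ca Nd Nc dc.
  have [q Gq [Pq [_ [_ fq]]]] := tcd c d ca Nc Nd (esym dc).
  by exists q => //; split=> //; split=> //; split=> // H genH Hq; rewrite fq.
Qed.

Lemma truth_mem a b : definable3 forces_eq -> N a -> N b ->
  truth (fun G => evaluate G a ∈ evaluate G b).
Proof.
move=> deq Na Nb G genG /in_evaluate[c [s [Gs cb ac]]].
have [Nc Ps] := names_in_dom Nb cb.
have [q Gq fq] := truth_eq deq Na Nc genG ac.
have [r Gr [rs rq]] := filter_dir genG.1 Gs Gq; exists r => // H genH Hr.
rewrite in_evaluate; exists c, s; split=> //; last exact: (forced_le rq fq).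
exact: (filter_up genH.1 Hr rs).
Qed.

Lemma definable_mem_of_eq : definable3 forces_eq ->
  (forall t, term M t -> definable_env M (fun e => N (t e))) ->
  definable3 forces_mem.
Proof.
move=> deq dN t u v tt tu tv.
apply: (@definable_env_ext _ (fun e => po_dom P (t e) /\ N (u e) /\ N (v e) /\
  forall q, M q -> po_le P q (t e) -> exists2 r, M r & po_le P r q /\
  exists2 c, M c & exists2 s, M s & ⟨c, s⟩ ∈ v e /\ po_le P r s /\
  forces_eq r (u e) c)); last first.
  by prove_definable.
move=> e Me; split=> -[Pp [Na [Nb fab]]]; split=> //; split=> //; split=> //.
(* A generic filter through [q] picks a pair [⟨c, s⟩] of [b] with [c] equal in value to [a]; the
   truth lemma for equality supplies a condition forcing this. *)
- move=> q Mq qp; have [G genG Gq] :=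
    generic_exists (ctm_countable hM) (po_le_dom qp).1.
  have /in_evaluate[c [s [Gs cb ac]]] := fab G genG (filter_up genG.1 Gq qp).
  have [Nc Ps] := names_in_dom Nb cb.
  have [r1 Gr1 fr1] := truth_eq deq Na Nc genG ac.
  have [r2 Gr2 [r2q r2s]] := filter_dir genG.1 Gq Gs.
  have [r Gr [rr1 rr2]] := filter_dir genG.1 Gr1 Gr2.
  have rq := po_le_trans rr2 r2q.
  exists r; first exact: po_leMl rq.
  split=> //; exists c; first exact: names_in.
  exists s; first exact: po_dom_in.
  split=> //; split; first exact: po_le_trans r2s.
  split; first exact: (po_le_dom rq).1.
  by split=> //; split=> //; apply: forced_le fr1.
- move=> G genG Gp; pose D : set V := [set r | po_dom P r /\
    exists2 c, M c & exists2 s, M s & ⟨c, s⟩ ∈ v e /\ po_le P r s /\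
    forces_eq r (u e) c].
  have [||q qp|r Gr [_ [c _ [s _ [cb [rs [_ [_ [_ ac]]]]]]]]] :=
    generic_meets (D := D) genG Gp.
  + by move=> q [].
  + have ta := term_const (names_in Na); have tb := term_const (names_in Nb).
    by rewrite /D /=; prove_definable.
  + have [r _ [rq rD]] := fab q (po_leMl qp) qp; exists r => //.
    by split=> //; exact: (po_le_dom rq).1.
  + apply/in_evaluate; exists c, s; split=> //; last exact: ac.
    exact: (filter_up genG.1 Gr rs).
Qed.

(** * All formulas *)

Definition forces_at n (f : formula n) p (s : n.-tuple V) : Prop :=
  po_dom P p /\ tuple_in N s /\ forces M P f p s.

Lemma forces_at_definable n (f : formula n) t (u : 'I_n -> (nat -> V) -> V) :
  definability_lemma M P f -> term M t -> (forall i, term M (u i)) ->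
  definable_env M (fun e => forces_at f (t e) [tuple u i e | i < n]).
Proof.
move=> df tt tu.
have tut (i : 'I_n.+1) : term M (oapp u t (unlift ord0 i)) by case: unlift.
apply: definable_env_ext (definable_env_definable df tut) => e _.
rewrite mktuple_oapp.
split=> [[Pp [Nu fp]]|[p [s [ps Pp Ns fp]]]]; last first.
  by have [-> ->] := cons_tuple_inj ps.
by exists (t e), [tuple u i e | i < n].
Qed.

Lemma definability_lemma_of_env n (f : formula n) :
  (forall t (u : 'I_n -> (nat -> V) -> V), term M t ->
    (forall i, term M (u i)) ->
    definable_env M (fun e => forces_at f (t e) [tuple u i e | i < n])) ->
  definability_lemma M P f.
Proof.
move=> df; have d0 := df (fun e => e 0) (fun i e => e i.+1) (term_var _ _)
  (fun i => term_var _ _).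
apply: (definable_of_env ctm_nonempty d0) => [s|e Me].
- move=> [p [w [-> Pp Nw _]]] i; case: (unliftP ord0 i) => [j|] ->.
    by rewrite tnth_consS; apply: names_in.
  exact: po_dom_in.
- rewrite mktuple_cons.
  have -> : [tuple e (val (lift ord0 i)) | i < n] = [tuple e i.+1 | i < n] by [].
  split=> [[p [s [ps Pp Ns fp]]]|[Pp [Ns fp]]].
    by have [-> ->] := cons_tuple_inj ps.
  by exists (e 0), [tuple e i.+1 | i < n].
Qed.

Lemma definable3_forces (f : formula 2) : definability_lemma M P f ->
  definable3 (fun p a b =>
    po_dom P p /\ N a /\ N b /\ forces M P f p [tuple a; b]).
Proof.
have forall2 (Q : 'I_2 -> Prop) : Q ord0 -> Q ord_max -> forall i, Q i.
  move=> Q0 Q1 [[|[|//]] i2].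
    by rewrite (_ : Ordinal i2 = ord0) //; apply/val_inj.
  by rewrite (_ : Ordinal i2 = ord_max) //; apply/val_inj.
move=> df t u v tt tu tv.
have tuv : forall i, term M (tnth [tuple u; v] i) by apply: forall2.
apply: definable_env_ext (forces_at_definable df tt tuv) => e _.
have -> : [tuple tnth [tuple u; v] i e | i < 2] = [tuple u e; v e].
  by apply: eq_from_tnth; apply: forall2; rewrite tnth_mktuple.
split=> [[Pp [Nu [Nv fp]]]|[Pp [Ns fp]]].
  by split=> //; split=> //; apply: forall2.
by split=> //; split; [exact: (Ns ord0)|split; [exact: (Ns ord_max)|]].
Qed.

Definition holds n (f : formula n) (s : n.-tuple V) (G : set V) : Prop :=
  sat (extension M (po_dom P) G) f [tuple of map (evaluate G) s].

(** The elements of the extension are exactly the values of names. *)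
Lemma holds_all n (f : formula n.+1) s G :
  holds (FAll f) s G <-> forall a, N a -> holds f [tuple of a :: s] G.
Proof.
have map_cons a : [tuple of map (evaluate G) [tuple of a :: s]] =
    [tuple of evaluate G a :: [tuple of map (evaluate G) s]] by apply: val_inj.
split=> [fs a Na|fs _ [a Na <-]].
  by rewrite /holds map_cons; apply: fs; exists a.
by rewrite -map_cons; apply: fs.
Qed.

(** Without conditions the forcing relation is empty and there is no generic filter. The case is
    separate because [definable_names] takes a condition as parameter. *)
Lemma forcing_theorem_empty n (f : formula n) :
  po_dom P = set0 -> forcing_theorem M P f.
Proof.
move=> P0; split.
  apply: definability_lemma_of_env => t u tt tu.
  apply: (@definable_env_ext _ (fun e => ~ t e = t e)); last by prove_definable.
  by move=> e _; split=> // -[]; rewrite P0.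
move=> s _ G [fG _]; have [p /(filter_sub fG)] := filter_nonempty fG.
by rewrite P0.
Qed.

(** Definability and truth go through one induction, since negation mixes them: [forced_neg] relies
    on truth for the negated formula, [truth_neg] also on definability of its forcing. *)
Lemma forcing_theorem_of_eq : definable3 forces_eq -> po_dom P !=set0 ->
  forall n (f : formula n), forcing_theorem M P f.
Proof.
move=> deq P0; have dN := definable_names deq P0.
have dmem := definable_mem_of_eq deq dN.
have dcons n (f : formula n.+1) t x (u : 'I_n -> (nat -> V) -> V) :
    (forall t (u : 'I_n.+1 -> (nat -> V) -> V), term M t ->
      (forall i, term M (u i)) ->
      definable_env M (fun e => forces_at f (t e) [tuple u i e | i < n.+1])) ->
    term M t -> term M x -> (forall i, term M (u i)) -> definable_env M
      (fun e => forces_at f (t e) [tuple of x e :: [tuple u i e | i < n]]).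
  move=> df tt tx tu.
  have tux (i : 'I_n.+1) : term M (oapp u x (unlift ord0 i)) by case: unlift.
  by apply: definable_env_ext (df t _ tt tux) => e _; rewrite mktuple_oapp.
have dtuple n (u : 'I_n -> (nat -> V) -> V) : (forall i, term M (u i)) ->
    definable_env M (fun e => tuple_in N [tuple u i e | i < n]).
  by move=> tu; apply: definable_env_tuple_in.
suff main n (f : formula n) :
    (forall t (u : 'I_n -> (nat -> V) -> V), term M t ->
      (forall i, term M (u i)) ->
      definable_env M (fun e => forces_at f (t e) [tuple u i e | i < n])) /\
    (forall s, tuple_in N s -> truth (holds f s)).
  move=> n f; have [df tf] := main n f.
  by split; [exact: definability_lemma_of_env|].
elim: f => {n} [n i j|n i j|n f [df tf]|n f [df tf] g [dg tg]|n f [df tf]].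
- have holdsE s : holds (FMem i j) s =
      fun G => evaluate G (tnth s i) ∈ evaluate G (tnth s j).
    by apply/funext => G; rewrite /holds /= !tnth_map.
  split=> [t u tt tu|s Ns]; last by rewrite holdsE; apply: truth_mem.
  (* Only components [i] and [j] enter [forces_mem], so that the others are names is required
     separately. *)
  apply: (@definable_env_ext _ (fun e => tuple_in N [tuple u i e | i < n] /\
    forces_mem (t e) (u i e) (u j e))); last by prove_definable.
  move=> e _; rewrite /forces_at -[forces _ _ _ _ _]/(forced (holds _ _) _).
  rewrite holdsE !tnth_mktuple; split=> [[Pp [Ns fp]]|[Ns [Pp [_ [_ fp]]]]//].
  by split=> //; split=> //; split; [have := Ns i|split; [have := Ns j|]];
    rewrite ?tnth_mktuple.
- have holdsE s : holds (FEq i j) s =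
      fun G => evaluate G (tnth s i) = evaluate G (tnth s j).
    by apply/funext => G; rewrite /holds /= !tnth_map.
  split=> [t u tt tu|s Ns]; last by rewrite holdsE; apply: truth_eq.
  apply: (@definable_env_ext _ (fun e => tuple_in N [tuple u i e | i < n] /\
    forces_eq (t e) (u i e) (u j e))); last by prove_definable.
  move=> e _; rewrite /forces_at -[forces _ _ _ _ _]/(forced (holds _ _) _).
  rewrite holdsE !tnth_mktuple; split=> [[Pp [Ns fp]]|[Ns [Pp [_ [_ fp]]]]//].
  by split=> //; split=> //; split; [have := Ns i|split; [have := Ns j|]];
    rewrite ?tnth_mktuple.
- split=> [t u tt tu|s Ns].
    apply: (@definable_env_ext _ (fun e => po_dom P (t e) /\
      tuple_in N [tuple u i e | i < n] /\ forall q, M q -> po_le P q (t e) ->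
      ~ forces_at f q [tuple u i e | i < n])); last by prove_definable.
    move=> e _; split=> -[Pp [Ns fp]]; split=> //; split=> //.
      move=> q _ qp [_ [_ fq]].
      by have /forced_neg := fp; move=> /(_ (tf _ Ns) Pp q qp); apply.
    apply/(forced_neg (tf _ Ns) Pp) => q qp fq.
    by apply: (fp q (po_leMl qp) qp); split=> //; exact: (po_le_dom qp).1.
  apply: truth_neg; first exact: tf.
  move=> t tt; have ts i : term M (fun=> tnth s i).
    exact/term_const/names_in/Ns.
  apply: definable_env_ext (df t _ tt ts) => e _.
  by rewrite mktuple_tnth; split=> [[]|[? []]].
- split=> [t u tt tu|s Ns]; last by apply: truth_and; [apply: tf|apply: tg].
  apply: (@definable_env_ext _ (fun e => forces_at f (t e) [tuple u i e | i < n]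
    /\ forces_at g (t e) [tuple u i e | i < n])); last by prove_definable.
  move=> e _; split=> [[Pp [Ns fp]]|[[Pp [Ns fp]] [_ [_ gp]]]].
    by split; split=> //; split=> // G genG Gp; case: (fp G genG Gp).
  by split=> //; split=> // G genG Gp; split; [apply: fp|apply: gp].
- have holdsE s : holds (FAll f) s =
      fun G => forall a, N a -> holds f [tuple of a :: s] G.
    by apply/funext => G; apply/propext; apply: holds_all.
  have Ncons a n' (s : n'.-tuple V) : N a -> tuple_in N s ->
      tuple_in N [tuple of a :: s].
    by move=> Na Ns i; case: (unliftP ord0 i) => [k|] ->; rewrite ?tnth_consS.
  split=> [t u tt tu|s Ns].
    (* Forcing a universal formula is forcing every instance; density enters only in its truth
       lemma. *)
    apply: (@definable_env_ext _ (fun e => po_dom P (t e) /\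
      tuple_in N [tuple u i e | i < n] /\ forall a, M a -> N a ->
      forces_at f (t e) [tuple of a :: [tuple u i e | i < n]])).
      move=> e _; rewrite /forces_at -[forces _ _ _ _ _]/(forced (holds _ _) _).
      rewrite holdsE; split=> -[Pp [Ns fp]]; split=> //; split=> //.
        move=> a _ Na; split=> //; split; first exact: Ncons.
        by move=> G genG Gp; apply: fp.
      move=> G genG Gp a Na; have [_ [_]] := fp a (names_in Na) Na.
      exact.
    by prove_definable.
  rewrite holdsE; apply: truth_all => // [a Na|t x tt tx].
    exact/tf/Ncons.
  have ts i : term M (fun=> tnth s i) by apply/term_const/names_in/Ns.
  apply: (@definable_env_ext _ (fun e => N (x e) /\ forces_at f (t e)
    [tuple of x e :: [tuple tnth s i | i < n]])); last first.
    by apply: definable_env_and; [apply: dN|apply: dcons].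
  move=> e _; rewrite mktuple_tnth; split=> [[Pp [Na fp]]|[Na [Pp [_ fp]]]//].
  by split=> //; split=> //; split=> //; apply: Ncons.
Qed.

End Forcing.

Theorem theorem1p1 (M : set V) (P : partial_order)
    (hM : ctm_ZFminus M) (hP : definable_order M P)
    (hdef : definability_lemma M P (FMem (ord0 : 'I_2) (ord_max : 'I_2)) \/
            definability_lemma M P (FEq (ord0 : 'I_2) (ord_max : 'I_2))) :
  forall (n : nat) (f : formula n), forcing_theorem M P f.
Proof.
have [P0|/set0P P0] := eqVneq (po_dom P) set0.
  by move=> n f; apply: forcing_theorem_empty.
apply: forcing_theorem_of_eq => //.
by case: hdef => /definable3_forces; [apply: definable_eq_of_mem|].
Qed.
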